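(* For $i=1,\dots,n$, let $(\mathcal P_i,\le_i)$ be finite posets and let $\mu_i,\nu_i$ be probability measures on $\mathcal P_i$ satisfying $\mu_i\preceq_{HS}\nu_i$. On the product poset $\mathcal P:=\prod_{i=1}^n\mathcal P_i$, endowed with its product order, consider the product measures $$\mu:=\bigotimes_{i=1}^n\mu_i,\qquad \nu:=\bigotimes_{i=1}^n\nu_i.$$ Then $\mu\preceq_{HS}\nu$ on $\mathcal P$.
   Context: For a finite poset $(\mathcal P,\le)$ and $x,z\in\mathcal P$, the hockey-stick function is $\Phi_x^{\mathcal P}(z):=\sum_{y\in\mathcal P}\mathbb 1_{\{x\le y\le z\}}$. For a signed measure $\rho$ on $\mathcal P$ and $f:\mathcal P\to\mathbb R$, $\langle\rho,f\rangle:=\int_{\mathcal P}f(x)\,\rho(dx)$. For signed measures $\mu,\nu$ on $\mathcal P$, $\mu\preceq_{HS}\nu$ means that $\langle\nu-\mu,\Phi_x^{\mathcal P}\rangle\ge0$ for every $x\in\mathcal P$. The product order on $\prod_i\mathcal P_i$ is componentwise: $(x_1,\dots,x_n)\le(y_1,\dots,y_n)$ if and only if $x_i\le_i y_i$ for all $i$. *)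

(* Defs.v *)
From HB Require Import structures.
From mathcomp Require Import all_boot all_order all_algebra.
From mathcomp Require Import all_classical all_reals all_analysis.

Set Implicit Arguments.
Unset Strict Implicit.
Unset Printing Implicit Defensive.

Import Order.TTheory GRing.Theory Num.Theory.
Import numFieldNormedType.Exports.

Local Open Scope classical_set_scope.
Local Open Scope ring_scope.

(* The finite poset P as a measurable space in which every subset is
   measurable. Measurable types carry a distinguished point in MathComp-Analysis,
   whence x0, which plays no other role; a poset that carries a probability
   measure is nonempty, so that requiring it costs no generality. *)
Definition discrete (d : Order.disp_t) (P : finPOrderType d) (x0 : P) : Type :=
  P.

HB.instance Definition _ d (P : finPOrderType d) (x0 : P) :=
  Finite.copy (discrete x0) P.

HB.instance Definition _ d (P : finPOrderType d) (x0 : P) :=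
  isPointed.Build (discrete x0) x0.

HB.instance Definition _ d (P : finPOrderType d) (x0 : P) :=
  @isMeasurable.Build default_measure_display (discrete x0)
    discrete_measurable discrete_measurable0
    discrete_measurableC discrete_measurableU.

Section prod_poset.
Variables (I : finType) (d : I -> Order.disp_t)
  (P : forall i, finPOrderType (d i)).

Definition prod_poset : Type := {dffun forall i : I, P i}.

HB.instance Definition _ := Finite.on prod_poset.

Fact prod_poset_display : Order.disp_t. Proof. exact: (Order.Disp tt tt). Qed.

Definition prod_le (x y : prod_poset) : bool := [forall i, (x i <= y i)%O].

Let prod_le_refl : reflexive prod_le.
Proof. by move=> x; apply/forallP => i. Qed.

Let prod_le_anti : antisymmetric prod_le.
Proof.
move=> x y /andP[/forallP xy /forallP yx]; apply/ffunP => i.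
by apply: le_anti; rewrite xy yx.
Qed.

Let prod_le_trans : transitive prod_le.
Proof.
move=> y x z /forallP xy /forallP yz; apply/forallP => i.
exact: le_trans (xy i) (yz i).
Qed.

HB.instance Definition _ := Order.Le_isPOrder.Build prod_poset_display
  prod_poset prod_le_refl prod_le_anti prod_le_trans.

Lemma prod_poset_leE (x y : prod_poset) :
  (x <= y)%O = [forall i, (x i <= y i)%O].
Proof. by []. Qed.

Definition prod_point (x0 : forall i, P i) : prod_poset :=
  ([ffun i => x0 i] : {dffun forall i : I, P i}).

End prod_poset.

Section pairing.
Context {d : measure_display} {T : measurableType d} {R : realType}.
Variable rho : {charge set T -> \bar R}.

Definition hahn_sets :
  {PN : set T * set T | hahn_decomposition rho PN.1 PN.2}.
Proof.
by apply: cid; have [P [N PN]] := Hahn_decomposition rho; exists (P, N).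
Qed.

(* The integral of f against the signed measure rho, through the Jordan
   decomposition of rho, which does not depend on the Hahn decomposition
   that is picked. *)
Definition pairing (f : T -> R) : R :=
  \int[jordan_pos (svalP hahn_sets)]_x f x -
  \int[jordan_neg (svalP hahn_sets)]_x f x.

End pairing.

Definition hockey_stick (R : realType) (d : Order.disp_t) (P : finPOrderType d)
    (x z : P) : R :=
  \sum_(y : P) ((x <= y) && (y <= z))%O%:R.

Definition hs_le (R : realType) (d : Order.disp_t) (P : finPOrderType d)
    (x0 : P) (mu nu : {charge set (discrete x0) -> \bar R}) : Prop :=
  forall x : P, 0 <= pairing (cadd nu (copp mu)) (hockey_stick R x).

(* Integration on a finite poset is summation against point masses. *)
Section finite_integral.
Context {R : realType} {d : Order.disp_t} {P : finPOrderType d} {x0 : P}.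
Local Notation T := (discrete x0).

Lemma Rintegral_discrete (m : {finite_measure set T -> \bar R}) (f : T -> R) :
  \int[m]_x f x = \sum_(x : P) f x * fine (m [set x]).
Proof.
have setTE : [set: T] = \big[setU/set0]_(x <- enum P) [set x : T].
  apply/seteqP; split=> x _ //; rewrite -bigcup_seq.
  by exists x => /=; rewrite ?mem_enum.
rewrite /Rintegral setTE integral_bigsetU_EFin//; last 2 first.
- exact: enum_uniq.
- by move=> x y _ _ [z [-> ->]].
rewrite big_enum/= (eq_bigr (fun x => (f x * fine (m [set x]))%:E)); last first.
  move=> x _; rewrite EFinM fineK ?fin_num_measure// -integral_cst//.
  by apply: eq_integral => y /[!inE] ->.
by rewrite sumEFin.
Qed.

Lemma measure_discrete (m : {finite_measure set T -> \bar R}) (A : set T) :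
  fine (m A) = \sum_(x : P) \1_A x * fine (m [set x]).
Proof.
by rewrite -Rintegral_discrete /Rintegral integral_indic// setIT.
Qed.

Lemma pairing_discrete (rho : {charge set T -> \bar R}) (f : T -> R) :
  pairing rho f = \sum_(x : P) f x * fine (rho [set x]).
Proof.
rewrite /pairing; set H := svalP _.
rewrite !Rintegral_discrete -sumrB; apply: eq_bigr => x _.
rewrite -mulrBr; congr (_ * _).
rewrite [in RHS](jordan_decomp H)// /cadd /= cscaleN1 /=.
by rewrite fineB// fin_num_measure.
Qed.

End finite_integral.

(* A sum of products over a finite product poset is a product of sums. *)
Lemma sum_prod_poset (R : realType) (I : finType) (d : I -> Order.disp_t)
    (P : forall i, finPOrderType (d i)) (F : forall i, P i -> R) :
  \sum_(x : prod_poset P) \prod_(i : I) F i (x i) =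
  \prod_(i : I) \sum_(y : P i) F i y.
Proof.
pose P' i : finType := P i.
pose F' i : {ffun P' i -> R} := [ffun y => F i y].
transitivity (\sum_(t : fprod P') \prod_(i in I) F' i (t i)).
  rewrite (reindex (@dffun_of_fprod I P'))/=; last first.
    exact/onW_bij/dffun_of_fprod_bij.
  by apply: eq_bigr => t _; apply: eq_bigr => i _; rewrite !ffunE.
rewrite big_fprod.
rewrite -(bigA_distr_big_dep (fun i => tagged_with P' i)
  (fun i j => untag 0 (F' i) j)).
apply: eq_bigr => i _; rewrite -(big_tag F').
by apply: eq_bigr => y _; rewrite ffunE.
Qed.

Section product_measure.
Context {R : realType} {I : finType} {d : I -> Order.disp_t}.
Context {P : forall i, finPOrderType (d i)} {x0 : forall i, P i}.
Variable mu : forall i, probability (discrete (x0 i)) R.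
Local Notation T := (discrete (prod_point x0)).

Definition product_mass (x : prod_poset P) : R :=
  \prod_(i : I) fine (mu i [set x i]).

Definition product_measure (A : set T) : \bar R :=
  (\sum_(x : prod_poset P) (product_mass x)%:E * \d_(x : T) A)%E.

Let product_mass_ge0 x : 0 <= product_mass x.
Proof. by apply: prodr_ge0 => i _; exact: fine_ge0. Qed.

Let product_measure0 : product_measure set0 = 0%E.
Proof.
by rewrite /product_measure big1// => x _; rewrite measure0 mule0.
Qed.

Let product_measure_ge0 A : (0 <= product_measure A)%E.
Proof. by apply: sume_ge0 => x _; rewrite mule_ge0// lee_fin. Qed.

Let product_measure_sigma_additive : semi_sigma_additive product_measure.
Proof.
move=> F mF tF mUF; rewrite [X in _ --> X](_ : _ =
    lim ((fun n => \sum_(0 <= i < n) product_measure (F i))%E @ \oo)).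
  by apply: is_cvg_ereal_nneg_natsum => k _.
rewrite nneseries_sum//; last by move=> *; rewrite mule_ge0// lee_fin.
apply: eq_bigr => /= x _.
rewrite nneseriesZl//; congr (_ * _)%E.
exact: (@measure_semi_bigcup _ _ _ (\d_(x : T))).
Qed.

HB.instance Definition _ := isMeasure.Build _ _ _ product_measure
  product_measure0 product_measure_ge0 product_measure_sigma_additive.

(* The defining property of the product measure. *)
Lemma product_measureE (A : forall i, set (discrete (x0 i))) :
  product_measure [set x : prod_poset P | forall i, A i (x i)] =
  (\prod_(i : I) mu i (A i))%E.
Proof.
transitivity (\prod_(i : I) fine (mu i (A i)))%:E; last first.
  rewrite -prodEFin; apply: eq_bigr => i _; rewrite fineK//.
  exact: fin_num_measure.
rewrite [in RHS](eq_bigr _ (fun i _ => measure_discrete (mu i) (A i))).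
rewrite -(@sum_prod_poset _ _ _ _
  (fun i (y : P i) => \1_(A i) y * fine (mu i [set y]))).
rewrite /product_measure -sumEFin; apply: eq_bigr => x _.
rewrite big_split/= EFinM muleC; congr (_ * _)%E.
rewrite diracE; congr (_%:E).
have [xA|/asboolPn/existsp_asboolPn[i xi]] := pselect (forall i, A i (x i)).
  by rewrite mem_set// big1// => i _; rewrite indicE mem_set.
rewrite memNset; last by move=> xA; apply: xi; exact: xA.
by rewrite (bigD1 i)//= indicE memNset// mul0r.
Qed.

Let product_measure_setT : product_measure setT = 1%E.
Proof.
transitivity (product_measure [set x : prod_poset P | forall i, setT (x i)]).
  by congr product_measure; apply/seteqP; split.
rewrite (product_measureE (fun=> setT)) big1// => i _.
exact: probability_setT.
Qed.

HB.instance Definition _ :=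
  Measure_isProbability.Build _ _ _ product_measure product_measure_setT.

End product_measure.

(* Main.v *)
Require Import Defs.
From HB Require Import structures.
From mathcomp Require Import all_boot all_order all_algebra.
From mathcomp Require Import all_classical all_reals all_analysis.

(** Both the hockey-stick functions and the product measures factor over the
    coordinates, so the integral of a hockey-stick function against a product
    measure is the product of the coordinate integrals, and these are
    nonnegative and pairwise ordered. *)

Set Implicit Arguments.
Unset Strict Implicit.
Unset Printing Implicit Defensive.

Import Order.TTheory GRing.Theory Num.Theory.

Local Open Scope classical_set_scope.
Local Open Scope ring_scope.

Lemma prod_natr_bool (R : realType) (I : finType) (b : I -> bool) :
  \prod_(i : I) (b i)%:R = [forall i, b i]%:R :> R.
Proof.
have [/forallP ball|/forallPn[i /negbTE bi]] := boolP [forall i, b i].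
  by rewrite big1// => i _; rewrite ball.
by rewrite (bigD1 i)//= bi mul0r.
Qed.

Lemma hockey_stick_ge0 (R : realType) (d : Order.disp_t) (P : finPOrderType d)
  (x z : P) : 0 <= hockey_stick R x z.
Proof. by apply: sumr_ge0 => y _; rewrite ler0n. Qed.

(** An interval of the product order is the product of the coordinate intervals, so its indicator is
    a product over [i]; summing that indicator over all [y] is an instance of [sum_prod_poset]. *)
Lemma hockey_stick_prod (R : realType) (I : finType) (d : I -> Order.disp_t)
    (P : forall i, finPOrderType (d i)) (x z : prod_poset P) :
  hockey_stick R x z = \prod_(i : I) hockey_stick R (x i) (z i).
Proof.
rewrite /hockey_stick -(sum_prod_poset
  (fun i (y : P i) => ((x i <= y) && (y <= z i))%O%:R)).
apply: eq_bigr => y _; rewrite prod_natr_bool !prod_poset_leE; congr (_%:R).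
congr nat_of_bool; apply/andP/forallP => [[/forallP xy /forallP yz] i|xyz].
  by rewrite xy yz.
by split; apply/forallP => i; have /andP[] := xyz i.
Qed.

(** Eliminates the signed measure and its Jordan decomposition: the pairing is a sum against point
    masses, which are finite, so it splits into a difference of two sums. Each side then involves a
    single measure and can be factored separately. *)
Lemma hs_leP (R : realType) (d : Order.disp_t) (P : finPOrderType d) (x0 : P)
    (mu nu : {finite_measure set (discrete x0) -> \bar R}) :
  hs_le (charge_of_finite_measure mu) (charge_of_finite_measure nu) <->
  forall x : P, \sum_(z : P) hockey_stick R x z * fine (mu [set z]) <=
                \sum_(z : P) hockey_stick R x z * fine (nu [set z]).
Proof.
have pairingE (x : P) : pairing (cadd (charge_of_finite_measure nu)
    (copp (charge_of_finite_measure mu))) (hockey_stick R x) =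
  \sum_(z : P) hockey_stick R x z * fine (nu [set z]) -
  \sum_(z : P) hockey_stick R x z * fine (mu [set z]).
  rewrite pairing_discrete -sumrB; apply: eq_bigr => z _.
  rewrite -mulrBr; congr (_ * _).
  by rewrite /cadd /= /copp /= fineB// fin_num_measure.
by split=> h x; have := h x; rewrite pairingE subr_ge0.
Qed.

Section product_measure.
Context {R : realType} {I : finType} {d : I -> Order.disp_t}.
Context {P : forall i, finPOrderType (d i)} {x0 : forall i, P i}.
Variable mu : forall i, probability (discrete (x0 i)) R.

Lemma product_measure_set1 (x : prod_poset P) :
  fine (product_measure mu [set x]) = \prod_(i : I) fine (mu i [set x i]).
Proof.
(* A singleton is a box with singleton sides, the shape that [product_measureE] evaluates. *)
have -> : [set x] = [set y : prod_poset P | forall i, [set x i] (y i)].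
  by apply/seteqP; split=> y /= => [-> //|yx]; apply/ffunP => i; exact: yx.
rewrite (product_measureE mu (fun i => [set x i])).
rewrite (eq_bigr (fun i => (fine (mu i [set x i]))%:E)) ?prodEFin// => i _.
by rewrite fineK// fin_num_measure.
Qed.

(** A finite Fubini theorem: the integrand and the point mass both factor over the coordinates,
    hence so does each summand. *)
Lemma sum_hockey_stick_product_measure (x : prod_poset P) :
  \sum_(z : prod_poset P)
    hockey_stick R x z * fine (product_measure mu [set z]) =
  \prod_(i : I) \sum_(z : P i) hockey_stick R (x i) z * fine (mu i [set z]).
Proof.
rewrite -(sum_prod_poset
  (fun i (z : P i) => hockey_stick R (x i) z * fine (mu i [set z]))).
apply: eq_bigr => z _.
by rewrite hockey_stick_prod product_measure_set1 -big_split.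
Qed.

End product_measure.

Theorem proposition5p1 (R : realType) (n : nat) (d : 'I_n -> Order.disp_t)
    (P : forall i : 'I_n, finPOrderType (d i)) (x0 : forall i : 'I_n, P i)
    (mu nu : forall i : 'I_n, probability (discrete (x0 i)) R)
    (mu_le_nu : forall i : 'I_n,
      hs_le (charge_of_finite_measure (mu i))
            (charge_of_finite_measure (nu i))) :
  hs_le (charge_of_finite_measure (product_measure mu))
        (charge_of_finite_measure (product_measure nu)).
Proof.
apply/hs_leP => x.
rewrite (sum_hockey_stick_product_measure mu).
rewrite (sum_hockey_stick_product_measure nu).
(* Multiplying the coordinate inequalities requires the smaller factors, those of [mu i], to be
   nonnegative as well. *)
apply: ler_prod => i _; apply/andP; split; last first.
  by move/hs_leP: (mu_le_nu i); apply.
by apply: sumr_ge0 => z _; rewrite mulr_ge0 ?hockey_stick_ge0 ?fine_ge0.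
Qed.
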